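(* Let $\Pi$ be an objective decomposition of $\{1,\ldots,p\}$, and let $S$ be a scalarization of finite cardinality for $\Pi$. Then, for any $\alpha \geq 1$, there exists an instance $I$ of a multiobjective ($p$-objective) optimization problem of type $\Pi$ such that the set of $S$-supported solutions is not an $\alpha$-approximation set.
   Context: The number of objectives $p \in \mathbb{N}\setminus\{0\}$ is a fixed constant. $\mathbb{R}^p_> = \{y \in \mathbb{R}^p : y_i > 0 \text{ for } i=1,\ldots,p\}$. An objective decomposition is a pair $\Pi = (\mathrm{MIN},\mathrm{MAX})$ with $\mathrm{MIN} \subseteq \{1,\ldots,p\}$ and $\mathrm{MAX} = \{1,\ldots,p\}\setminus \mathrm{MIN}$. For $y,y'\in\mathbb{R}^p$, $y <_\Pi y'$ means $y_i < y'_i$ for all $i\in\mathrm{MIN}$ and $y_i > y'_i$ for all $i \in \mathrm{MAX}$. A $p$-objective optimization problem of type $\Pi$ is a set of instances; each instance $I=(X,f)$ consists of a set $X$ of feasible solutions and a map $f=(f_1,\ldots,f_p)$ on $X$, where $f_i$ is to be minimized for $i \in \mathrm{MIN}$ and maximized for $i\in\mathrm{MAX}$. Standing assumption: in every instance, $f(X)$ is a compact subset of $\mathbb{R}^p_>$. For $\alpha\ge 1$, $x\in X$ $\alpha$-approximates $x' \in X$ if $f_i(x) \le \alpha f_i(x')$ for all $i\in\mathrm{MIN}$ and $f_i(x) \ge \frac1\alpha f_i(x')$ for all $i\in\mathrm{MAX}$. A set $P\subseteq X$ is an $\alpha$-approximation set if every $x'\in X$ is $\alpha$-approximated by some $x\in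 P$. A scalarizing function for $\Pi$ is a continuous function $s:\mathbb{R}^p_>\to\mathbb{R}$ such that $y <_\Pi y'$ for $y,y'\in\mathbb{R}^p_>$ implies $s(y)<s(y')$. A scalarization for $\Pi$ is a set of scalarizing functions for $\Pi$. In an instance $(X,f)$ of type $\Pi$, $x\in X$ is optimal for $s$ if $s(f(x))\le s(f(x'))$ for all $x'\in X$, and $x$ is $S$-supported if it is optimal for some $s\in S$.
   Formalization: The number of objectives p is assumed to be at least 2: for p = 1 and nonempty S the claim fails, since an optimal solution of a scalarizing function then optimizes the single objective, exists by compactness, and 1-approximates every feasible solution. *)

(* Defs.v *)
From HB Require Import structures.
From mathcomp Require Import all_boot all_order all_algebra.
From mathcomp Require Import all_classical all_reals all_analysis.

Set Implicit Arguments.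
Unset Strict Implicit.
Unset Printing Implicit Defensive.

Import Order.TTheory GRing.Theory Num.Theory numFieldNormedType.Exports.

Local Open Scope classical_set_scope.
Local Open Scope ring_scope.

Record decomposition (p : nat) := Decomposition {
  MIN : {set 'I_p};
  MAX : {set 'I_p};
  MAX_compl : MAX = finset.setC MIN
}.

Definition pos_orthant (R : realType) (p : nat) : set 'rV[R]_p :=
  [set y | forall i, 0 < y ord0 i].

Definition lt_decomp (R : realType) (p : nat) (Pi : decomposition p)
    (y y' : 'rV[R]_p) : Prop :=
  (forall i, i \in MIN Pi -> y ord0 i < y' ord0 i) /\
  (forall i, i \in MAX Pi -> y ord0 i > y' ord0 i).

(* The feasible set is the type [feasible] itself.  The data of an instance do
   not depend on [Pi]; the index records which objectives are minimized. *)
Record instance (R : realType) (p : nat) (Pi : decomposition p) := Instance {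
  feasible : Type;
  obj : feasible -> 'rV[R]_p;
  obj_compact : compact (range obj);
  obj_pos : range obj `<=` @pos_orthant R p
}.

Definition approximates (R : realType) (p : nat) (Pi : decomposition p)
    (I : instance R Pi) (alpha : R) (x x' : feasible I) : Prop :=
  (forall i, i \in MIN Pi -> obj x ord0 i <= alpha * obj x' ord0 i) /\
  (forall i, i \in MAX Pi -> obj x ord0 i >= alpha^-1 * obj x' ord0 i).

Definition approximation_set (R : realType) (p : nat) (Pi : decomposition p)
    (I : instance R Pi) (alpha : R) (P : set (feasible I)) : Prop :=
  forall x', exists2 x, P x & approximates alpha x x'.

(* A map R^p_> -> R is represented by a total function constrained only on
   the positive orthant; its values elsewhere are irrelevant. *)
Definition scalarizing (R : realType) (p : nat) (Pi : decomposition p)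
    (s : 'rV[R]_p -> R) : Prop :=
  {within @pos_orthant R p, continuous s} /\
  (forall y y', pos_orthant y -> pos_orthant y' ->
     lt_decomp Pi y y' -> s y < s y').

Definition scalarization (R : realType) (p : nat) (Pi : decomposition p)
    (S : set ('rV[R]_p -> R)) : Prop :=
  forall s, S s -> scalarizing Pi s.

Definition optimal (R : realType) (p : nat) (Pi : decomposition p)
    (I : instance R Pi) (s : 'rV[R]_p -> R) (x : feasible I) : Prop :=
  forall x' : feasible I, s (obj x) <= s (obj x').

Definition supported (R : realType) (p : nat) (Pi : decomposition p)
    (I : instance R Pi) (S : set ('rV[R]_p -> R)) : set (feasible I) :=
  [set x | exists2 s, S s & optimal s x].
Arguments supported {R p Pi} I S _.

(* Main.v *)
(** Write an objective vector in coordinates [z] in which every objective is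
    minimized, inverting the maximized ones.  Place #|S| + 1 points along a curve
    on which one coordinate of [z] grows geometrically and the others decay
    geometrically, so that no point approximates another.  Scaling [z] by a
    factor [c] strictly increases every scalarizing function, so, choosing the
    factors one after the other while avoiding finitely many bad values, we can
    make each [s \in S] injective on the points.  Each [s] then supports at most
    one point, so that some point is unsupported and hence not approximated. *)
Require Import Defs.
From HB Require Import structures.
From mathcomp Require Import all_boot all_order all_algebra.
From mathcomp Require Import all_classical all_reals all_analysis.
From mathcomp Require Import lra.

Set Implicit Arguments.
Unset Strict Implicit.
Unset Printing Implicit Defensive.

Import Order.TTheory GRing.Theory Num.Theory numFieldNormedType.Exports.

Local Open Scope classical_set_scope.
Local Open Scope ring_scope.

(** Induction on [n]: since [f \o g n] is injective, each pair of an [f] in [F] and an earlier index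
    [i] rules out at most one value of [m n]. Finitely many values are thus bad, and [nat] is
    infinite. *)
Lemma separating_selection (T V : Type) (F : set (T -> V))
    (g : nat -> nat -> T) (n : nat) :
    finite_set F -> (forall f j, F f -> injective (f \o g j)) ->
  exists m : nat -> nat, forall f i j, F f -> (i < j < n)%N ->
    f (g i (m i)) <> f (g j (m j)).
Proof.
move=> finF injF; elim: n => [|n [m mP]].
  by exists id => f i j _; rewrite ltn0 andbF.
pose bad := \bigcup_(f in F) \bigcup_(i in `I_n)
  ((f \o g n) @^-1` [set f (g i (m i))]).
have fin_bad : finite_set bad.
  apply: bigcup_finite => // f Ff; apply: bigcup_finite => // i _.
  by apply: finite_preimage => // x y _ _; exact: injF Ff _ _.
have /infinite_setN0[k [_ kP]] := infinite_setD infinite_nat fin_bad.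
exists (fun i => if i == n then k else m i) => f i j Ff /andP[ij].
rewrite ltnS leq_eqVlt => /orP[/eqP jn|jn].
  rewrite jn eqxx ltn_eqF -?jn // jn => fik.
  by apply: kP; exists f => //; exists i; rewrite //= -jn.
by rewrite !ltn_eqF ?(ltn_trans ij) //; apply: mP; rewrite ?ij.
Qed.

Section Construction.
Context (R : realType) (p : nat) (Pi : decomposition p).

Definition of_costs (z : 'I_p -> R) : 'rV[R]_p :=
  \row_i (if i \in MIN Pi then z i else (z i)^-1).

Lemma MAXE i : (i \in MAX Pi) = (i \notin MIN Pi).
Proof. by rewrite MAX_compl finset.in_setC. Qed.

Lemma of_costs_pos z : (forall i, 0 < z i) -> @pos_orthant R p (of_costs z).
Proof. by move=> z0 i; rewrite mxE; case: ifP; rewrite ?invr_gt0. Qed.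

Lemma of_costs_lt z z' : (forall i, 0 < z i) -> (forall i, z i < z' i) ->
  lt_decomp Pi (of_costs z) (of_costs z').
Proof.
move=> z0 zz'; split=> i.
  by move=> iMIN; rewrite !mxE iMIN.
rewrite MAXE => /negbTE iMAX; rewrite !mxE iMAX ltf_pV2 ?posrE //.
exact: lt_trans (zz' i).
Qed.

(** Inversion turns the bound with [alpha^-1] on a maximized objective into the bound with [alpha]
    on its cost, so both kinds of objectives obey one inequality. *)
Lemma approximates_costs (I : instance R Pi) (alpha : R) (x x' : feasible I)
    (z z' : 'I_p -> R) :
    0 < alpha -> (forall i, 0 < z i) -> (forall i, 0 < z' i) ->
    obj x = of_costs z -> obj x' = of_costs z' ->
  approximates alpha x x' -> forall i, z i <= alpha * z' i.
Proof.
move=> a0 z0 z'0 xz xz' [minP maxP] i; have [iMIN|iMAX] := boolP (i \in MIN Pi).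
  by have := minP i iMIN; rewrite xz xz' !mxE iMIN.
have := maxP i; rewrite MAXE iMAX xz xz' !mxE (negbTE iMAX) => /(_ isT).
by rewrite -invfM lef_pV2 ?posrE ?mulr_gt0.
Qed.

Definition staircase (i0 : 'I_p) (B : R) (j : nat) (i : 'I_p) : R :=
  if i == i0 then B ^+ j else B ^- j.

Lemma staircase_gt0 i0 B j i : 0 < B -> 0 < staircase i0 B j i.
Proof. by move=> B0; rewrite /staircase; case: ifP; rewrite ?invr_gt0 exprn_gt0. Qed.

(** If [j' < j], the growing coordinate [i0] shows the gap; if [j < j'], the decaying coordinate
    [i1] does. *)
Lemma staircase_gap i0 i1 B j j' : i0 != i1 -> 1 <= B -> j != j' ->
  exists i, B * staircase i0 B j' i <= staircase i0 B j i.
Proof.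
move=> i01 B1 jj'; have B0 : 0 < B by exact: lt_le_trans ltr01 B1.
have gap k l : (k < l)%N -> B * B ^+ k <= B ^+ l.
  by move=> kl; rewrite -exprS ler_weXn2l.
case: (ltngtP j j') jj' => // jj' _.
  exists i1; rewrite /staircase eq_sym (negbTE i01).
  rewrite ler_pdivrMr ?exprn_gt0 // mulrC ler_pdivlMr ?exprn_gt0 //.
  exact: gap.
by exists i0; rewrite /staircase eqxx gap.
Qed.

End Construction.

Theorem theorem4p1 (R : realType) (p : nat) (hp : (1 < p)%N)
    (Pi : decomposition p) (S : set ('rV[R]_p -> R))
    (hS : scalarization Pi S) (Sfin : finite_set S)
    (alpha : R) (halpha : 1 <= alpha) :
  exists I : instance R Pi, ~ approximation_set alpha (supported I S).
Proof.
have [ss Sss] := (finite_seqP S).1 Sfin.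
pose n := (size ss).+1.
pose i0 : 'I_p := Ordinal (ltnW hp).
pose i1 : 'I_p := Ordinal hp.
(* The scaling factors below lie in []1, 2]], so they can shrink a gap of [4 * alpha] to no less
   than [2 * alpha], still above [alpha]. *)
pose B : R := 4 * alpha.
have B1 : 1 <= B by rewrite /B; lra.
have B0 : 0 < B by lra.
(* Infinitely many distinct factors within a bounded range. *)
pose c (m : nat) : R := 1 + m.+1%:R^-1.
have c_gt1 m : 1 < c m by rewrite ltrDl invr_gt0 ltr0n.
have c_le2 m : c m <= 2.
  by rewrite /c (_ : 2 = 1 + 1 :> R) // lerD2l invf_le1 ?ler1n ?ltr0n.
have c_dec m m' : (m < m')%N -> c m' < c m.
  by move=> mm'; rewrite ltrD2l ltf_pV2 ?posrE ?ltr0n // ltr_nat.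
pose z j m i := c m * staircase i0 B j i.
have z_gt0 j m i : 0 < z j m i.
  by rewrite mulr_gt0 ?staircase_gt0 // (lt_trans ltr01).
pose g j m := of_costs Pi (z j m).
have g_dec s j m m' : S s -> (m < m')%N -> s (g j m') < s (g j m).
  move=> /hS[_ s_mono] mm'; apply: s_mono; [exact: of_costs_pos..|].
  by apply: of_costs_lt => // i; rewrite ltr_pM2r ?staircase_gt0 ?c_dec.
have g_inj s j : S s -> injective (s \o g j).
  move=> Ss m m' /= eqs; case: (ltngtP m m') => // mm'.
    by have := g_dec s j _ _ Ss mm'; rewrite eqs ltxx.
  by have := g_dec s j _ _ Ss mm'; rewrite eqs ltxx.
have [m mP] := separating_selection n Sfin g_inj.
pose f (j : 'I_n) := g j (m j).
have f_sep s : S s -> injective (s \o f).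
  move=> Ss j j' /= eqs; apply: val_inj.
  case: (ltngtP (val j) (val j')) => // jj'.
    by case: (mP s j j' Ss); rewrite ?jj' ?ltn_ord.
  by case: (mP s j' j Ss); rewrite ?jj' ?ltn_ord.
have f_compact : compact (range f).
  exact/finite_compact/finite_image.
have f_pos : range f `<=` @pos_orthant R p.
  by move=> _ [j _ <-]; exact: of_costs_pos.
pose I := Instance Pi f_compact f_pos; exists I => apxS.
have approx_eq (j j' : feasible I) : approximates alpha j j' -> j = j'.
  move=> apx; apply: contrapT => /eqP jj'.
  have i01 : i0 != i1 by [].
  have [i gapi] := staircase_gap i01 B1 (jj' : val j != val j').
  have := @approximates_costs _ _ _ I _ j j' (z j (m j)) (z j' (m j'))
    (lt_le_trans ltr01 halpha) (z_gt0 _ _) (z_gt0 _ _) erefl erefl apx i.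
  apply/negP; rewrite -ltNge /z.
  have := staircase_gt0 i0 j' i B0; have := staircase_gt0 i0 j i B0.
  move: gapi; rewrite /B.
  set u := staircase _ _ _ _; set v := staircase _ _ _ _.
  move=> gapi v0 u0.
  have av0 : 0 < alpha * u by rewrite mulr_gt0 //; lra.
  have : c (m j') * (alpha * u) <= 2 * (alpha * u) by rewrite ler_pM2r.
  have : 1 * v < c (m j) * v by rewrite ltr_pM2r.
  lra.
(* Only [j] itself approximates [j], so every point must be supported; [sel] picks a witness for
   each. *)
have /choice[sel selP] (j : 'I_n) :
    exists s, S s /\ forall j', s (f j) <= s (f j').
  by have [k [s Ss optk] /approx_eq <-] := apxS j; exists s.
have sel_inj : injective sel.
  move=> j j' eqsel; apply: (f_sep (sel j)); first exact: (selP j).1.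
  by apply/eqP; rewrite /= eq_le (selP j).2 eqsel (selP j').2.
(* Pigeonhole: [sel] would inject [(size ss).+1] points into [ss]. *)
have : (size (codom sel) <= size ss)%N.
  apply: uniq_leq_size; first exact/injectiveP.
  by move=> _ /codomP[j ->]; have := (selP j).1; rewrite Sss.
by rewrite size_codom card_ord ltnn.
Qed.
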